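(* As $x\to\infty$, \[ \sum_{\substack{m,n\in\mathbb{N}\\ mn\le x}} \frac{\gcd(m,n)}{\operatorname{lcm}(m,n)} = \frac{\zeta^2(3/2)}{\zeta(3)}\,x^{1/2} + O\!\left((\log x)^3\right). \]
   Context: $\zeta$ is the Riemann zeta function. The sum is over ordered pairs of positive integers $(m,n)$ with $mn\le x$. *)

(* Defs.v *)
From HB Require Import structures.
From mathcomp Require Import all_boot all_order all_algebra.
From mathcomp Require Import all_classical all_reals all_analysis.

Set Implicit Arguments.
Unset Strict Implicit.
Unset Printing Implicit Defensive.

Import Order.TTheory GRing.Theory Num.Theory.
Import numFieldNormedType.Exports.

Local Open Scope ring_scope.
Local Open Scope classical_set_scope.

(* The Riemann zeta function at a real argument s > 1, as its Dirichlet series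
   1/1^s + 1/2^s + 1/3^s + ... ([riemannR s n] is 1/(n+1)^s).  For s <= 1 the
   series diverges and the value is meaningless. *)
Definition zeta (R : realType) (s : R) : R := limn (series (riemannR s)).

(* Sum over the ordered pairs of positive integers with m n <= x.  The bound
   [Num.truncn x], the integer part of x, is only there to make the ranges
   finite: m n <= x with m, n >= 1 forces m, n <= [Num.truncn x]. *)
Definition gcd_lcm_sum (R : realType) (x : R) : R :=
  \sum_(1 <= m < (Num.truncn x).+1)
    \sum_(1 <= n < (Num.truncn x).+1 | (m * n)%:R <= x)
      (gcdn m n)%:R / (lcmn m n)%:R.

(* Lets the Landau notations, which infer a bundled filter, accept +oo. *)
Canonical pinfty_filter_on (R : realType) :=
  FilterType (pinfty_nbhs R) (@filter_filter R _ proper_pinfty_nbhs).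

(* Main.v *)
(* Grouping the pairs (m, n) = (g a, g b) with a, b coprime by their gcd g, the
   sum is  sum_(a, b coprime) floor(sqrt(x / ab)) / ab,  where a, b run up to
   floor x.  Dropping the integer part costs at most
   (sum_(a <= x) 1 / a)^2 = O(log^2 x), and leaves sqrt x times a partial sum of
   sum_(a, b coprime) (ab)^(-3/2), whose tail is O(x^(-1/2)).  Grouping by gcd
   the terms of the square of the partial sums of zeta(3/2) shows that the full
   sum is zeta(3/2)^2 / zeta(3). *)

Require Import Defs.
From mathcomp Require Import all_boot all_order all_algebra.
From mathcomp Require Import all_classical all_reals all_analysis.
From mathcomp Require Import lra ring zify.

Set Implicit Arguments.
Unset Strict Implicit.

Import Order.TTheory GRing.Theory Num.Theory.
Import numFieldNormedType.Exports.

Local Open Scope ring_scope.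
Local Open Scope classical_set_scope.

(** * Regrouping a sum over pairs by the gcd *)

Section GcdSums.
Variable V : nmodType.

Lemma sum_multiples (N g : nat) (G : nat -> V) : (0 < g)%N ->
  \sum_(1 <= m < N.+1 | (g %| m)%N) G m
  = \sum_(1 <= a < N.+1 | (g * a <= N)%N) G (g * a)%N.
Proof.
move=> g0; rewrite -[LHS]big_filter -[RHS]big_filter.
rewrite -(big_map (muln g) predT G); apply/perm_big/uniq_perm.
- by rewrite filter_uniq ?iota_uniq.
- rewrite map_inj_uniq ?filter_uniq ?iota_uniq // => a b /eqP.
  by rewrite eqn_pmul2l // => /eqP.
- move=> m; rewrite mem_filter mem_index_iota; apply/idP/mapP.
    move=> /andP[/dvdnP[a ->] /andP[ga0 gaN]]; exists a; last by rewrite mulnC.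
    by rewrite mem_filter mem_index_iota; nia.
  by move=> [a]; rewrite mem_filter mem_index_iota => ? ->; rewrite dvdn_mulr //; nia.
Qed.

(** Each pair has exactly one gcd g, which lies in 1..N because it divides m; dividing both entries
    by g leaves a coprime pair. *)
Lemma sum_by_gcd (N : nat) (F : nat -> nat -> V) :
  \sum_(1 <= m < N.+1) \sum_(1 <= n < N.+1) F m n
  = \sum_(1 <= g < N.+1) \sum_(1 <= a < N.+1 | (g * a <= N)%N)
      \sum_(1 <= b < N.+1 | (g * b <= N)%N)
        (if coprime a b then F (g * a)%N (g * b)%N else 0).
Proof.
transitivity (\sum_(1 <= m < N.+1) \sum_(1 <= g < N.+1) \sum_(1 <= n < N.+1)
    if g == gcdn m n then F m n else 0).
  apply: eq_big_nat => m mN; rewrite exchange_big; apply: eq_big_nat => n nN /=.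
  rewrite -big_mkcond big_nat1_eq ifT // gcdn_gt0.
  by have := dvdn_leq _ (dvdn_gcdl m n); lia.
rewrite exchange_big; apply: eq_big_nat => g /andP[g0 gN] /=.
(* A pair with gcd g has both entries divisible by g, so restricting to multiples of g removes only
   zeros. *)
transitivity (\sum_(1 <= m < N.+1 | (g %| m)%N) \sum_(1 <= n < N.+1 | (g %| n)%N)
    if g == gcdn m n then F m n else 0).
  rewrite [RHS]big_mkcond; apply: eq_bigr => m _.
  case: ifPn => [_|gm]; last first.
    by apply: big1 => n _; rewrite ifN //; apply: contraNneq gm => ->; exact: dvdn_gcdl.
  rewrite [RHS]big_mkcond; apply: eq_bigr => n _.
  by case: eqVneq => [->|_]; rewrite ?dvdn_gcdr ?if_same.
rewrite sum_multiples //; apply: eq_bigr => a _.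
rewrite sum_multiples //; apply: eq_bigr => b _.
by rewrite -muln_gcdr -{1}[g]muln1 eqn_pmul2l // eq_sym.
Qed.

End GcdSums.

Section Main.
Variable R : realType.
Implicit Types (x y : R) (k n N M : nat).

(** * Elementary estimates: counting, tails of zeta(3/2), harmonic sums *)

Lemma sum_count y N : 0 <= y -> (Num.truncn y <= N)%N ->
  \sum_(1 <= g < N.+1 | g%:R <= y) (1 : R) = (Num.truncn y)%:R.
Proof.
move=> y0 yN; rewrite [RHS](_ : _ = \sum_(1 <= g < (Num.truncn y).+1) (1 : R)).
  rewrite [RHS](big_nat_widen _ _ N.+1) //; apply: eq_bigl => g.
  by rewrite ltnS truncn_ge_nat.
by rewrite sumr_const_nat subn1.
Qed.

(* n^(-3/2) *)
Definition pown32 n : R := (n%:R * Num.sqrt n%:R)^-1.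

Lemma pown32_ge0 n : 0 <= pown32 n.
Proof. by rewrite invr_ge0 mulr_ge0 ?sqrtr_ge0. Qed.

Lemma pown32M a b : pown32 (a * b) = pown32 a * pown32 b.
Proof. by rewrite /pown32 natrM sqrtrM // mulrACA invfM. Qed.

Lemma pown32X2 n : pown32 (n ^ 2) = (n%:R ^+ 3)^-1.
Proof. by rewrite /pown32 natrX sqrtr_sqr ger0_norm // -exprSr. Qed.

(** Comparison with a telescoping sum: b^(-3/2) <= 4/sqrt b - 4/sqrt(b+1). *)
Lemma sum_pown32_tail k M : (0 < k)%N -> \sum_(k <= b < M) pown32 b <= 4 / Num.sqrt k%:R.
Proof.
move=> k0; have [Mk|kM] := leqP M k.
  by rewrite big_geq // divr_ge0 ?sqrtr_ge0.
pose f n : R := - (4 / Num.sqrt n%:R).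
apply: (@le_trans _ _ (\sum_(k <= b < M) (f b.+1 - f b))); last first.
  rewrite telescope_sumr; last exact: ltnW.
  by rewrite /f opprK addrC gerBl divr_ge0 ?sqrtr_ge0.
apply: ler_sum_nat => b /andP[kb _].
have b0 : (0 < b)%N by exact: leq_trans kb.
rewrite /f /pown32 opprK.
have eb : Num.sqrt b%:R ^+ 2 = b%:R :> R by rewrite sqr_sqrtr.
have eb1 : Num.sqrt b.+1%:R ^+ 2 = b.+1%:R :> R by rewrite sqr_sqrtr.
have s0 : 0 < Num.sqrt b%:R :> R by rewrite sqrtr_gt0 ltr0n.
have t0 : 0 < Num.sqrt b.+1%:R :> R by rewrite sqrtr_gt0 ltr0n.
have st : Num.sqrt b%:R <= Num.sqrt b.+1%:R :> R by rewrite ler_sqrt // ler_nat.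
move: eb1; rewrite -[in RHS]natr1 -[in RHS]eb => eb1.
have b1 : 1 <= Num.sqrt b%:R ^+ 2 :> R by rewrite eb ler1n.
move: eb s0 t0 st eb1 b1.
move: (Num.sqrt b%:R) (Num.sqrt b.+1%:R) => s t <- s0 t0 st eb1 b1.
rewrite -subr_ge0.
rewrite (_ : _ - _ = (4 * s ^+ 2 * (t - s) - t) / (s ^+ 3 * t)); last first.
  by field; rewrite !gt_eqF.
apply: divr_ge0; last by rewrite ltW // mulr_gt0 ?exprn_gt0.
(* Multiplying by t + s reduces the claim to t^2 + t s <= 4 s^2. This holds since t s <= t^2 = s^2 +
   1 <= 2 s^2, whence the constant 4. *)
have ts : (t - s) * (t + s) = 1 by rewrite -subr_sqr eb1; ring.
rewrite -(pmulr_lge0 _ (addr_gt0 t0 s0)) mulrBl -[_ * (t - s) * _]mulrA ts mulr1.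
rewrite mulrDr -expr2.
have := ler_wpM2l (ltW t0) st; rewrite -expr2; lra.
Qed.

Lemma harmonic_le_ln N : (0 < N)%N -> \sum_(1 <= a < N.+1) (a%:R : R)^-1 <= 1 + ln N%:R.
Proof.
case: N => // N _; elim: N => [|N IH].
  by rewrite big_nat1 invr1 ln1 addr0.
rewrite big_nat_recr //=; apply: le_trans (lerD IH (lexx _)) _.
(* The bound ln(1 + u) <= u at u = -1/(N+2) gives 1/(N+2) <= ln(N+2) - ln(N+1). *)
have := @le_ln1Dx R (- N.+2%:R^-1).
rewrite ltrN2 invf_lt1 ?ltr1n ?ltr0n // => /(_ isT).
rewrite (_ : 1 + _ = N.+1%:R / N.+2%:R); last first.
  have nz : N.+2%:R != 0 :> R by rewrite pnatr_eq0.
  apply: (mulIf nz); rewrite mulrDl mulNr divfK // mulVf // mul1r -natr1.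
  exact: addrK.
rewrite ln_div ?posrE ?ltr0n //.
by rewrite -addrA lerD2l lerBlDl -lerBrDr.
Qed.

(** * Partial sums of zeta(3/2) and zeta(3) *)

Lemma riemannR32E n : riemannR (3 / 2) n = pown32 n.+1 :> R.
Proof.
rewrite /riemannR /pown32 (_ : 3 / 2 = 1 + 2^-1); last by field.
by rewrite powRD ?pnatr_eq0 ?implybT // powRr1 // powR12_sqrt.
Qed.

Lemma riemannR3E n : riemannR 3 n = (n.+1%:R ^+ 3)^-1 :> R.
Proof. by rewrite /riemannR powR_mulrn. Qed.

Lemma cvg_zeta32 : (fun N => \sum_(1 <= n < N.+1) pown32 n) @ \oo --> zeta (3 / 2 : R).
Proof.
rewrite (_ : (fun N => _) = series (riemannR (3 / 2))); last first.
  apply/funext => N; rewrite /series /= big_add1 /=.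
  by apply: eq_bigr => n _; rewrite -riemannR32E.
apply: nondecreasing_is_cvgn.
  by apply: nondecreasing_series => n _ _; rewrite riemannR32E pown32_ge0.
exists 4 => _ [N _ <-]; have := @sum_pown32_tail 1 N.+1 isT; rewrite sqrtr1 divr1.
by rewrite big_add1; under eq_bigr do rewrite -riemannR32E.
Qed.

(** Writing n^(-3) as (n^2)^(-3/2) gives the form in which zeta(3) arises from grouping by gcd. *)
Lemma cvg_zeta3 : (fun N => \sum_(1 <= n < N.+1) pown32 (n ^ 2)) @ \oo --> zeta (3 : R).
Proof.
rewrite (_ : (fun N => _) = series (riemannR 3)); last first.
  apply/funext => N; rewrite /series /= big_add1 /=.
  by apply: eq_bigr => n _; rewrite pown32X2 -riemannR3E.
apply: nondecreasing_is_cvgn.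
  by apply: nondecreasing_series => n _ _; rewrite riemannR3E invr_ge0 exprn_ge0.
(* Since n^(-3) <= n^(-3/2), the bound 4 for the partial sums of zeta(3/2) serves again. *)
exists 4 => _ [N _ <-]; have := @sum_pown32_tail 1 N.+1 isT; rewrite sqrtr1 divr1.
apply: le_trans; rewrite big_add1; apply: ler_sum => n _ /=.
rewrite riemannR3E -pown32X2 -mulnn pown32M -[leRHS]mul1r ler_wpM2r ?pown32_ge0 //.
rewrite /pown32 invf_le1 ?mulr_gt0 ?sqrtr_gt0 //.
by rewrite mulr_ege1 ?ler1n // -[leLHS]sqrtr1 ler_wsqrtr // ler1n.
Qed.

Lemma zeta3_neq0 : zeta (3 : R) != 0.
Proof.
rewrite gt_eqF // (lt_le_trans ltr01) // -(cvg_lim _ cvg_zeta3) //.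
apply: limr_ge; first by apply/cvg_ex; eexists; exact: cvg_zeta3.
exists 1%N => // N /= N0; rewrite big_ltn // ler_wpDr //.
  by apply: sumr_ge0 => n _; exact: pown32_ge0.
by rewrite /pown32 sqrtr1 mulr1 invr1.
Qed.

(** * The sum over coprime pairs and its limit *)

(** The cutoff is the square a, b <= N, matching the ranges in [gcd_lcm_sumE]. *)
Definition coprime_sum N : R :=
  \sum_(1 <= a < N.+1) \sum_(1 <= b < N.+1 | coprime a b) pown32 (a * b).

(** The pair (g a, g b) has weight (g^2)^(-3/2) (ab)^(-3/2), so the gcd splits off as a term of
    zeta(3). *)
Lemma sqr_sum_pown32E N : (\sum_(1 <= n < N.+1) pown32 n) ^+ 2
  = \sum_(1 <= g < N.+1) pown32 (g ^ 2) *
      \sum_(1 <= a < N.+1 | (g * a <= N)%N)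
      \sum_(1 <= b < N.+1 | (g * b <= N)%N && coprime a b) pown32 (a * b).
Proof.
rewrite expr2 big_distrlr /= sum_by_gcd; apply: eq_bigr => g _.
rewrite mulr_sumr; apply: eq_bigr => a _; rewrite mulr_sumr.
rewrite -big_mkcondr; apply: eq_bigr => b _.
by rewrite -!pown32M mulnACA.
Qed.

(** Dropping the cutoffs g a <= N and g b <= N only adds nonnegative terms. *)
Lemma sqr_sum_pown32_le N : (\sum_(1 <= n < N.+1) pown32 n) ^+ 2
  <= (\sum_(1 <= g < N.+1) pown32 (g ^ 2)) * coprime_sum N.
Proof.
rewrite sqr_sum_pown32E mulr_suml; apply: ler_sum => g _.
apply: ler_wpM2l; first exact: pown32_ge0.
rewrite /coprime_sum big_mkcond; apply: ler_sum => a _; case: ifP => _; last first.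
  by apply: sumr_ge0 => b _; exact: pown32_ge0.
rewrite big_mkcond [leRHS]big_mkcond; apply: ler_sum => b _.
by case: coprime; rewrite ?andbF // andbT; case: ifP; rewrite ?pown32_ge0.
Qed.

(** If g, a, b <= N then g a, g b <= N^2, so each term of the product occurs in the grouped square
    for N^2. *)
Lemma le_sqr_sum_pown32 N : (\sum_(1 <= g < N.+1) pown32 (g ^ 2)) * coprime_sum N
  <= (\sum_(1 <= n < (N * N).+1) pown32 n) ^+ 2.
Proof.
have [->|N0] := posnP N; first by rewrite big_geq // mul0r sqr_ge0.
have NN : (N.+1 <= (N * N).+1)%N by rewrite ltnS leq_pmulr.
rewrite sqr_sum_pown32E mulr_suml [leRHS](@big_cat_nat _ _ _ N.+1) //= ler_wpDr //.
  apply: sumr_ge0 => g _; rewrite mulr_ge0 ?pown32_ge0 //; apply: sumr_ge0 => a _.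
  by apply: sumr_ge0 => b _; exact: pown32_ge0.
apply: ler_sum_nat => g /andP[g0 gN]; apply: ler_wpM2l; first exact: pown32_ge0.
rewrite /coprime_sum (big_nat_widen _ N.+1 (N * N).+1) //=.
rewrite big_mkcond [leRHS]big_mkcond; apply: ler_sum => a _; case: ifP => aN; last first.
  by case: ifP => // _; apply: sumr_ge0 => b _; exact: pown32_ge0.
rewrite ifT; last by rewrite leq_mul.
rewrite (big_nat_widen _ N.+1 (N * N).+1) //=.
rewrite big_mkcond [leRHS]big_mkcond; apply: ler_sum => b _.
case: ifP => [/andP[-> bN]|_]; last by case: ifP; rewrite ?pown32_ge0.
by rewrite ifT // andbT leq_mul.
Qed.

(** The two preceding bounds squeeze the product between squares of partial sums of zeta(3/2) at N
    and at N^2; it remains to divide by zeta(3). *)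
Lemma cvg_coprime_sum : coprime_sum @ \oo --> zeta (3 / 2 : R) ^+ 2 / zeta 3.
Proof.
have zN0 N : (0 < N)%N -> \sum_(1 <= g < N.+1) pown32 (g ^ 2) != 0.
  move=> N0; rewrite gt_eqF // big_ltn // ltr_wpDr //.
    by apply: sumr_ge0 => n _; exact: pown32_ge0.
  by rewrite /pown32 sqrtr1 mulr1 invr1.
have sq : (fun N => (\sum_(1 <= n < N.+1) pown32 n) ^+ 2) @ \oo --> zeta (3 / 2 : R) ^+ 2.
  rewrite expr2; under eq_fun do rewrite expr2.
  by apply: cvgM; exact: cvg_zeta32.
have sq2 : (fun N => (\sum_(1 <= n < (N * N).+1) pown32 n) ^+ 2) @ \oo --> zeta (3 / 2 : R) ^+ 2.
  apply: (@cvg_comp _ _ _ (fun N => (N * N)%N) _ _ _ _ _ sq) => A [n _ nA].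
  exists n => // m /= nm; apply: nA => /=; nia.
have prod : (fun N => (\sum_(1 <= g < N.+1) pown32 (g ^ 2)) * coprime_sum N) @ \oo
    --> zeta (3 / 2 : R) ^+ 2.
  apply: squeeze_cvgr sq sq2; apply: nearW => N.
  by rewrite sqr_sum_pown32_le le_sqr_sum_pown32.
apply: (@cvg_trans _ ((fun N => (\sum_(1 <= g < N.+1) pown32 (g ^ 2)) * coprime_sum N
   / \sum_(1 <= g < N.+1) pown32 (g ^ 2)) @ \oo)).
  (* The divisor is an empty sum at N = 0, so it is cancelled from N = 1 on. *)
  apply: near_eq_cvg; exists 1%N => // N /= N0.
  by rewrite mulrAC mulfV ?mul1r // zN0.
by apply: cvgM => //; apply: cvgV; [exact: zeta3_neq0|exact: cvg_zeta3].
Qed.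

(* In a pair of the tail a or b exceeds N; the two cases contribute
   at most 4 * (4 / sqrt (N + 1)) each. *)
Lemma coprime_sum_tail N M : (N <= M)%N ->
  coprime_sum N <= coprime_sum M <= coprime_sum N + 32 / Num.sqrt N.+1%:R.
Proof.
move=> NM; have NM1 : (N.+1 <= M.+1)%N by [].
have h0 n p q : 0 <= \sum_(p <= b < q | coprime n b) pown32 (n * b).
  by apply: sumr_ge0 => b _; exact: pown32_ge0.
have hle p q p' q' : (0 < p)%N -> (0 < p')%N ->
    \sum_(p <= a < q) \sum_(p' <= b < q' | coprime a b) pown32 (a * b)
    <= 4 / Num.sqrt p%:R * (4 / Num.sqrt p'%:R).
  move=> p0 p0'; have c0 : 0 <= 4 / Num.sqrt p'%:R :> R by rewrite divr_ge0 ?sqrtr_ge0.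
  apply: le_trans (ler_wpM2r c0 (sum_pown32_tail q p0)); rewrite mulr_suml.
  apply: ler_sum => a _; apply: le_trans (ler_wpM2l (pown32_ge0 a) (sum_pown32_tail q' p0')).
  rewrite mulr_sumr big_mkcond; apply: ler_sum => b _.
  by case: ifP => _; rewrite ?pown32M // mulr_ge0 ?pown32_ge0.
have -> : coprime_sum M = coprime_sum N
    + \sum_(1 <= a < N.+1) \sum_(N.+1 <= b < M.+1 | coprime a b) pown32 (a * b)
    + \sum_(N.+1 <= a < M.+1) \sum_(1 <= b < M.+1 | coprime a b) pown32 (a * b).
  rewrite /coprime_sum (@big_cat_nat _ _ _ N.+1) //=; congr (_ + _).
  rewrite -big_split /=; apply: eq_bigr => a _.
  by rewrite (@big_cat_nat _ _ _ N.+1).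
rewrite -!addrA lerDl addr_ge0 ?sumr_ge0 //= lerD2l.
have := hle 1%N N.+1 N.+1 M.+1 isT isT.
have := hle N.+1 M.+1 1%N M.+1 isT isT.
rewrite sqrtr1 divr1 => e1 e2.
by apply: le_trans (lerD e2 e1) _; lra.
Qed.

(** Let M tend to infinity in [coprime_sum_tail], with N fixed. *)
Lemma coprime_sum_lim N : let L := zeta (3 / 2 : R) ^+ 2 / zeta 3 in
  coprime_sum N <= L <= coprime_sum N + 32 / Num.sqrt N.+1%:R.
Proof.
have cv : cvgn coprime_sum by apply/cvg_ex; eexists; exact: cvg_coprime_sum.
rewrite /= -(cvg_lim _ cvg_coprime_sum) //; apply/andP; split.
  by apply: limr_ge => //; exists N => // M /= /coprime_sum_tail /andP[].
by apply: limr_le => //; exists N => // M /= /coprime_sum_tail /andP[].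
Qed.

(** * The gcd-lcm sum and its error term *)

(** For coprime a, b the pair (g a, g b) contributes 1/(ab), and its product is at most x exactly
    when g <= sqrt(x/(ab)); the integer part counts these g. *)
Lemma gcd_lcm_sumE x : 0 <= x -> let N := Num.truncn x in
  gcd_lcm_sum x = \sum_(1 <= a < N.+1) \sum_(1 <= b < N.+1 | coprime a b)
    (Num.truncn (Num.sqrt (x / (a * b)%:R)))%:R / (a * b)%:R.
Proof.
move=> x0 N; rewrite /gcd_lcm_sum -/N.
transitivity (\sum_(1 <= g < N.+1) \sum_(1 <= a < N.+1)
    \sum_(1 <= b < N.+1 | coprime a b)
      if (g%:R <= Num.sqrt (x / (a * b)%:R))%R then (a * b)%:R^-1 else 0 : R).
  under eq_bigr do rewrite big_mkcond.
  rewrite sum_by_gcd; apply: eq_big_nat => g /andP[g0 gN].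
  rewrite big_mkcond; apply: eq_big_nat => a /andP[a0 aN].
  have cond b : (0 < b)%N ->
      (g%:R <= Num.sqrt (x / (a * b)%:R)) = ((g * a * (g * b))%:R <= x).
    move=> b0; rewrite -[g%:R]ger0_norm // -sqrtr_sqr ler_sqrt; last first.
      by rewrite divr_ge0.
    by rewrite ler_pdivlMr ?ltr0n ?muln_gt0 ?a0 // -natrX -natrM -mulnn mulnACA.
  (* Applied with c = g^2 ab: the cutoffs g a <= N and g b <= N follow from c <= x. *)
  have small b c : (0 < b)%N -> (b <= c)%N -> c%:R <= x -> (b <= N)%N.
    move=> b0 bc cx; apply: leq_trans bc _; by rewrite truncn_ge_nat.
  transitivity (\sum_(1 <= b < N.+1) if [&& (g * a <= N)%N, (g * b <= N)%N, coprime a b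
     & (g * a * (g * b))%:R <= x] then (a * b)%:R^-1 else 0 : R).
    case: ifP => gaN; last by rewrite big1.
    rewrite big_mkcond; apply: eq_big_nat => b /andP[b0 _] /=.
    case: ifP => //= gbN; case: ifP => //= /eqP ab; case: ifP => // _.
    rewrite -muln_gcdr ab muln1.
    have -> : lcmn (g * a) (g * b) = (g * (a * b))%N.
      by rewrite -muln_lcmr -(muln_lcm_gcd a b) ab muln1.
    by rewrite natrM invfM mulrA mulfV ?mul1r // pnatr_eq0 -lt0n.
  rewrite [RHS]big_mkcond; apply: eq_big_nat => b /andP[b0 _].
  rewrite cond //; case: (boolP (_ <= x)) => [h|_]; last by rewrite !andbF if_same.
  rewrite !(small _ _ _ _ h) ?muln_gt0 ?g0 ?a0 ?b0 ?leq_pmulr ?leq_pmull ?muln_gt0 ?g0 ?a0 //=.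
  by rewrite andbT.
rewrite exchange_big; apply: eq_big_nat => a /andP[a0 aN] /=.
rewrite exchange_big /= big_nat_cond [RHS]big_nat_cond.
apply: eq_bigr => b /andP[/andP[b0 bN] _].
rewrite -big_mkcond -(@sum_count _ N) ?sqrtr_ge0 //.
  by rewrite mulr_suml; apply: eq_bigr => g _; rewrite mul1r.
(* The range 1..N contains every g to be counted: k <= k^2 <= x/(ab) <= x. *)
set k := Num.truncn _; have [->//|k0] := posnP k.
have ky : k%:R <= Num.sqrt (x / (a * b)%:R) by rewrite truncn_le sqrtr_ge0.
rewrite truncn_ge_nat //; apply: (@le_trans _ _ ((k ^ 2)%:R)).
  by rewrite ler_nat -mulnn leq_pmulr.
rewrite natrX; apply: (@le_trans _ _ (x / (a * b)%:R)).
  rewrite -[leRHS]sqr_sqrtr ?divr_ge0 // ler_pXn2r // ?nnegrE ?sqrtr_ge0 //.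
rewrite ler_pdivrMr ?ltr0n ?muln_gt0 ?a0 // ler_peMr // ler1n muln_gt0 a0.
exact: b0.
Qed.

Lemma gcd_lcm_sum_approx x : 1 <= x ->
  `|gcd_lcm_sum x - zeta (3 / 2 : R) ^+ 2 / zeta 3 * Num.sqrt x|
  <= (1 + ln x) ^+ 2 + 32.
Proof.
move=> x1; have x0 : 0 < x by exact: lt_le_trans x1.
set N := Num.truncn x; set L := _ / _.
have N0 : (0 < N)%N by rewrite truncn_gt0.
have Nx : N%:R <= x by rewrite truncn_le ltW.
(* The intermediate value drops the integer parts but keeps the cutoff at N. *)
rewrite -(subrKA (coprime_sum N * Num.sqrt x)).
apply: le_trans (ler_normD _ _) _; apply: lerD; last first.
  have /andP[l1 l2] := coprime_sum_lim N.
  rewrite distrC -mulrBl ger0_norm ?mulr_ge0 ?subr_ge0 ?sqrtr_ge0 //.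
  apply: (@le_trans _ _ (32 / Num.sqrt N.+1%:R * Num.sqrt x)).
    by rewrite ler_wpM2r ?sqrtr_ge0 // lerBlDl.
  (* As x < N + 1, the ratio sqrt x / sqrt(N+1) is at most 1. *)
  rewrite -mulrA ler_piMr // mulrC ler_pdivrMr ?sqrtr_gt0 // mul1r.
  by rewrite ler_wsqrtr // ltW // truncnS_gt.
apply: (@le_trans _ _ ((\sum_(1 <= a < N.+1) (a%:R : R)^-1) ^+ 2)); last first.
  have h0 : 0 <= \sum_(1 <= a < N.+1) (a%:R : R)^-1.
    by apply: sumr_ge0 => a _; rewrite invr_ge0.
  have h := harmonic_le_ln N0.
  have hx : ln N%:R <= ln x :> R by rewrite ler_ln ?posrE ?ltr0n.
  have hh := le_trans h (lerD (lexx 1) hx).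
  by rewrite ler_pXn2r ?nnegrE // (le_trans h0).
rewrite gcd_lcm_sumE ?(ltW x0) // -/N /coprime_sum mulr_suml -sumrB.
apply: le_trans (ler_norm_sum _ _ _) _.
rewrite expr2 big_distrlr /=; apply: ler_sum_nat => a /andP[a0 _].
rewrite mulr_suml -sumrB; apply: le_trans (ler_norm_sum _ _ _) _.
rewrite big_mkcond; apply: ler_sum_nat => b /andP[b0 _].
case: ifP => _; last by rewrite mulr_ge0 ?invr_ge0.
have ab0 : 0 < (a * b)%:R :> R by rewrite ltr0n muln_gt0 a0.
set y := Num.sqrt (x / (a * b)%:R).
(* Each coprime pair thus costs the fractional part of y divided by ab, hence at most 1/(ab). *)
have -> : pown32 (a * b) * Num.sqrt x = y / (a * b)%:R.
  by rewrite /pown32 /y sqrtrM ?(ltW x0) // sqrtrV ?(ltW ab0) // invfM; ring.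
rewrite -mulrBl normrM [`|_^-1|]ger0_norm ?invr_ge0 // natrM invfM.
rewrite ler_piMl ?mulr_ge0 ?invr_ge0 //.
have /andP[y1 y2] := truncn_itv (sqrtr_ge0 (x / (a * b)%:R)).
rewrite distrC ger0_norm ?subr_ge0 // lerBlDl natr1; exact: ltW.
Qed.

End Main.

Theorem theorem9 (R : realType) :
  @gcd_lcm_sum R
    = (fun x : R => zeta (3 / 2) ^+ 2 / zeta 3 * x `^ (1 / 2))
    +O_ +oo (fun x : R => ln x ^+ 3).
Proof.
(* 36 = 1 + 2 + 1 + 32: for x > e, so that ln x >= 1, each power of ln x in the expanded bound (1 +
   ln x)^2 + 32 is at most (ln x)^3. *)
apply/eqaddOP; exists 36; split => // k k36.
near=> x.
have xe : expR 1 < x by near: x; exact: nbhs_pinfty_gt.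
have x1 : 1 < x by apply: lt_trans xe; rewrite expR_gt1.
have lx : 1 <= ln x by rewrite -[leLHS]expRK ler_ln ?posrE ?expR_gt0 ?(lt_trans ltr01) // ltW.
rewrite /= (_ : (_ - _) x = gcd_lcm_sum x - zeta (3 / 2) ^+ 2 / zeta 3 * Num.sqrt x); last first.
  by rewrite !fctE div1r powR12_sqrt // ltW // (lt_trans ltr01).
apply: le_trans (gcd_lcm_sum_approx (ltW x1)) _.
have l3 : ln x ^+ 2 <= ln x ^+ 3 by rewrite [leRHS]exprS ler_peMl // sqr_ge0.
have l2 : 1 <= ln x ^+ 2 by rewrite exprn_ege1.
have l1 : ln x <= ln x ^+ 2 by rewrite expr2 ler_peMr // (le_trans ler01).
have l0 : 0 <= ln x ^+ 3 by rewrite exprn_ge0 // (le_trans ler01).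
rewrite ger0_norm //; apply: (@le_trans _ _ (36 * ln x ^+ 3)).
  rewrite sqrrD expr1n; lra.
by rewrite ler_wpM2r // ltW.
Unshelve. all: by end_near.
Qed.
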